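(* Assume the generalized continuum hypothesis. Let $(Y,\le_Y)$ be a nonempty partially ordered set, let $\alpha$ be an infinite cardinal and let $(P,\le_P)$ be an $\alpha$-universal poset. The following are equivalent. (i) $(Y,\le_Y)$ is an $\alpha$-quasilattice. (ii) For every poset $(X,\le_X)$ with $|X|<\alpha$ and every $A\subseteq X$, every isotone map $f\colon A\to Y$ extends to an isotone map $X\to Y$. (iii) For every poset $(X,\le_X)$ and every $A\subseteq X$ with $|A|<\alpha$, every isotone map $f\colon A\to Y$ extends to an isotone map $X\to Y$. (iv) For every $A\subseteq P$ with $|A|<\alpha$, every isotone map $f\colon A\to Y$ extends to an isotone map $P\to Y$.
   Context: A map is isotone if $x\le y$ implies $f(x)\le f(y)$; subsets carry the induced order; an extension of $f\colon A\to Y$ is a map agreeing with $f$ on $A$. For an infinite cardinal $\alpha$, a poset $(Y,\le_Y)$ is an $\alpha$-quasilattice if for all $A,B\subseteq Y$ with $|A|<\alpha$, $|B|<\alpha$ and $a\le_Y b$ for all $a\in A$, $b\in B$, there exists $y^*\in Y$ with $a\le_Y y^*\le_Y b$ for all $a\in A$, $b\in B$. A poset $(P,\le_P)$ is $\alpha$-universal if every poset $(X,\le_X)$ with $|X|<\alpha$ is order-isomorphic to some subset of $P$ with the induced order. *)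

(* Defs.v *)
From HB Require Import structures.
From mathcomp Require Import all_boot all_order.
From mathcomp Require Import mathcomp_extra boolp classical_sets functions.
From mathcomp Require Import cardinality.

Set Implicit Arguments.
Unset Strict Implicit.
Unset Printing Implicit Defensive.

Local Open Scope classical_set_scope.
Local Open Scope card_scope.
Local Open Scope order_scope.

(* Cardinals are represented by types: an infinite cardinal is a type K with
   infinite_set [set: K], and |A| < K is card_lt A [set: K]. *)
Definition card_lt (T U : Type) (A : set T) (B : set U) : Prop :=
  A #<= B /\ A #!= B.

(* 2 ^ |T| is the cardinal successor of |T| for every infinite T; note that
   set T is the power set T -> Prop. *)
Definition GCH : Prop :=
  forall T U : Type, infinite_set [set: T] ->
    ~ (card_lt [set: T] [set: U] /\ card_lt [set: U] [set: set T]).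

(* The induced order on subsets: a set A coerces to the type {x | x \in A}. *)
HB.instance Definition _ (d : Order.disp_t) (X : porderType d) (p : pred X) :=
  [SubChoice_isSubPOrder of {x : X | p x} by <: with d].

(* f : A -> Y extends to an isotone map defined on all of X. *)
Definition isotone_extends (dX dY : Order.disp_t) (X : porderType dX)
    (Y : porderType dY) (A : set X) (f : A -> Y) : Prop :=
  exists2 g : X -> Y, Order.nondecreasing g & forall x : A, g (val x) = f x.

Definition quasilattice (K : Type) (d : Order.disp_t) (Y : porderType d) :
    Prop :=
  forall A B : set Y, card_lt A [set: K] -> card_lt B [set: K] ->
    (forall a b, A a -> B b -> a <= b) ->
    exists y : Y, (forall a, A a -> a <= y) /\ (forall b, B b -> y <= b).

Definition order_isomorphic (d1 d2 : Order.disp_t) (X1 : porderType d1)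
    (X2 : porderType d2) : Prop :=
  exists2 e : X1 -> X2, bijective e & {mono e : x y / x <= y}.

Definition universal (K : Type) (d : Order.disp_t) (P : porderType d) : Prop :=
  forall (dX : Order.disp_t) (X : porderType dX), card_lt [set: X] [set: K] ->
    exists S : set P, order_isomorphic X S.

(* Main.v *)
(* The point is (i) => (iii).  Since [f] is isotone, it only matters for [x : X]
   which elements of [A] lie below and above it, so [f] may be extended along
   the map from [X] to the set [Q] of pairs of subsets of [A], ordered by
   inclusion and reverse inclusion.  Under GCH, [#|Q| <= alpha],
   so [Q] has a well-order whose initial segments have cardinality [< alpha];
   along it the values are chosen one by one, each choice being an instance of the
   [alpha]-quasilattice property.
   Conversely, (i) is the extension property for the poset made of two
   antichains [A] and [B] and a middle point; this poset has fewer than [alpha]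
   elements and embeds in [P]. *)

From HB Require Import structures.
Require Import Defs.
From mathcomp Require Import all_boot all_order.
From mathcomp Require Import boolp classical_sets functions cardinality.
From mathcomp Require Import wochoice.

Set Implicit Arguments.
Unset Strict Implicit.
Unset Printing Implicit Defensive.

Import Order.TTheory.

Local Open Scope classical_set_scope.
Local Open Scope card_scope.
Local Open Scope order_scope.

(** * Comparison and arithmetic of cardinals *)

(** The relation need not be functional: a choice extracts the injection, which spares work with the
    subtypes of [A] and [B]. *)
Lemma card_le_relP T U (A : set T) (B : set U) :
  A #<= B <-> exists R : T -> U -> Prop,
    (forall x, A x -> exists2 y, B y & R x y) /\
    (forall x x' y, A x -> A x' -> R x y -> R x' y -> x = x').
Proof.
split=> [/card_leP[f]|[R [totR injR]]].
  exists (fun x y => exists a : A, val a = x /\ val (f a) = y); split.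
    move=> x Ax; exists (val (f (SigSub (mem_set Ax)))).
      exact/set_mem/valP.
    by exists (SigSub (mem_set Ax)).
  move=> _ _ y _ _ [a [<- <-]] [a' [<- ffa]].
  by congr val; apply: (@inj _ _ _ f); rewrite ?in_setT//; exact/val_inj.
have /choice[f fR] : forall a : A, exists b : B, R (val a) (val b).
  move=> a; have [y By Ry] := totR _ (set_mem (valP a)).
  by exists (SigSub (mem_set By)).
apply/card_leP/injfunPex; exists f => // a a' _ _ ffa.
apply/val_inj/(injR _ _ (val (f a))) => //; try exact/set_mem/valP.
by rewrite ffa.
Qed.

(** Zorn's lemma gives a maximal graph of a partial bijection; were it neither total on [A] nor onto
    [B], a pair of missed points would extend it. *)
Lemma card_le_total T U (A : set T) (B : set U) : A #<= B \/ B #<= A.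
Proof.
pose P (F : set (T * U)) := (forall p, F p -> A p.1 /\ B p.2) /\
  (forall p q, F p -> F q -> p.1 = q.1 <-> p.2 = q.2).
have [Fs FsP Fst|F [[FAB FI] Fmax]] := @Zorn_bigcup _ P.
  split=> [p [X /FsP[+ _] Xp]|p q [X FX Xp] [Y FY Yq]]; first exact.
  have [XY|YX] := Fst _ _ FX FY.
    by have [_] := FsP _ FY; apply => //; apply: XY.
  by have [_] := FsP _ FX; apply => //; apply: YX.
have [totF|/existsNP[x /not_implyP[Ax nFx]]] :=
    pselect (forall x, A x -> exists2 y, B y & F (x, y)).
  left; apply/card_le_relP; exists (fun x y => F (x, y)); split=> //.
  by move=> x x' y _ _ Fx Fx'; apply: (FI _ _ Fx Fx').2.
have [surF|/existsNP[y /not_implyP[By nFy]]] :=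
    pselect (forall y, B y -> exists2 x, A x & F (x, y)).
  right; apply/card_le_relP; exists (fun y x => F (x, y)); split=> //.
  by move=> y y' z _ _ Fy Fy'; apply: (FI _ _ Fy Fy').1.
exfalso; apply: (Fmax (F `|` [set (x, y)])).
  split=> [p|]; first by left.
  move=> /(_ (x, y)) Fxy; apply: nFx; exists y => //.
  by apply: Fxy; right.
split=> [p [/FAB//|->]//|p q [Fp|->] [Fq|->]] //=; first exact: FI.
- split=> E; exfalso.
    by apply: nFx; exists p.2; have [] := FAB _ Fp;
      rewrite // -E -surjective_pairing.
  by apply: nFy; exists p.1; have [] := FAB _ Fp;
      rewrite // -E -surjective_pairing.
- split=> E; exfalso.
    by apply: nFx; exists q.2; have [] := FAB _ Fq;
      rewrite // E -surjective_pairing.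
  by apply: nFy; exists q.1; have [] := FAB _ Fq;
      rewrite // E -surjective_pairing.
Qed.

Lemma card_ltNge T U (A : set T) (B : set U) : card_lt A B <-> ~ (B #<= A).
Proof.
split=> [[AB /negP nAB] BA|BA]; first by apply: nAB; rewrite card_eq_le AB.
have [AB|//] := card_le_total A B; split=> //.
by apply/negP; rewrite card_eq_le => /andP[].
Qed.

Lemma card_le_lt_trans T U V (A : set T) (B : set U) (C : set V) :
  A #<= B -> card_lt B C -> card_lt A C.
Proof.
by rewrite !card_ltNge => AB BC CA; apply: BC; exact: card_le_trans CA AB.
Qed.

Lemma card_lt_setT T U (A : set T) (B : set U) :
  card_lt A B -> card_lt [set: A] B.
Proof.
by apply: card_le_lt_trans; have := card_setT A; rewrite card_eq_le => /andP[].
Qed.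

Lemma card_le_infinite T U (A : set T) (B : set U) :
  finite_set A -> infinite_set B -> A #<= B.
Proof.
by have [//|BA fA []] := card_le_total A B; apply: card_le_finite fA.
Qed.

Lemma card_lt_finite T U (A : set T) (B : set U) :
  finite_set A -> infinite_set B -> card_lt A B.
Proof.
by move=> fA iB; apply/card_ltNge => BA; apply: iB; exact: card_le_finite BA fA.
Qed.

Lemma card_leX T U V (A : set T) (B : set U) (C : set V) :
  A #<= B -> A `*` C #<= B `*` C.
Proof.
move=> /card_le_relP[R [totR injR]]; apply/card_le_relP.
exists (fun p q => R p.1 q.1 /\ p.2 = q.2); split=> [[x z] [/= Ax Cz]|].
  by have [y By Rxy] := totR _ Ax; exists (y, z).
move=> [x z] [x' z'] [y w] /= [/= Ax _] [/= Ax' _] [/= Rx ->] [Rx' ->].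
by rewrite (injR _ _ _ Ax Ax' Rx Rx').
Qed.

Lemma card_leU T U (A B : set T) (C : set U) :
  A #<= C -> B #<= C -> A `|` B #<= C `*` [set: bool].
Proof.
move=> /card_le_relP[R [totR injR]] /card_le_relP[S [totS injS]].
apply/card_le_relP.
exists (fun x p => if p.2 then A x /\ R x p.1 else B x /\ S x p.1); split.
  move=> x [Ax|Bx]; first by have [y Cy Rxy] := totR _ Ax; exists (y, true).
  by have [y Cy Sxy] := totS _ Bx; exists (y, false).
move=> x x' [y []] /= _ _ [Ax Rx] [Ax' Rx']; first exact: injR Rx Rx'.
exact: injS Rx Rx'.
Qed.

(* A maximal [F] injects [D x bool] into [D] for a subset [D] of [E]; any
   infinite part of [E \ D] would provide a copy of [nat] extending [F], so
   [E \ D] is finite and absorbed by [D]. *)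
Lemma card_le_doubling T (E : set T) :
  infinite_set E -> E `*` [set: bool] #<= E.
Proof.
move=> Einf.
(* The existential clauses make the domain of [F] of the form [D x bool] and keep its values in
   [D]. *)
pose P (F : set ((T * bool) * T)) :=
  (forall x b y, F ((x, b), y) -> [/\ E x, E y,
     exists z, F ((x, ~~ b), z) & exists z, F ((y, true), z)]) /\
  (forall p q, F p -> F q -> p.2 = q.2 -> p.1 = q.1).
have [Fs FsP Fst|F [[FE FI] Fmax]] := @Zorn_bigcup _ P.
  split=> [x b y [X FX Xp]|p q [X FX Xp] [Y FY Yq]].
    have [/(_ _ _ _ Xp)[Ex Ey [z zP] [w wP]] _] := FsP _ FX.
    by split=> //; [exists z|exists w]; exists X.
  have [XY|YX] := Fst _ _ FX FY.
    by have [_] := FsP _ FY; apply => //; apply: XY.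
  by have [_] := FsP _ FX; apply => //; apply: YX.
pose D := [set x | exists y, F ((x, true), y)].
have DE : D `<=` E by move=> x [y /FE[]].
have DD : D `*` [set: bool] #<= D.
  apply/card_le_relP; exists (fun p y => F (p, y)); split.
    move=> [x [|]] [/= [y Fy] _].
      by exists y => //; have [] := FE _ _ _ Fy.
    have [_ _ [z Fz] _] := FE _ _ _ Fy.
    by exists z => //; have [] := FE _ _ _ Fz.
  by move=> p q y _ _ Fp Fq; apply: (FI _ _ Fp Fq).
have EDfin : finite_set (E `\` D).
  apply: contrapT => /infiniteP/card_leP[f].
  have fD n : (E `\` D) (val (f n)) by exact/set_mem/valP.
  pose g n : T := val (f (SigSub (mem_set (I : [set: nat] n)))).
  have gE n : E (g n) by have [] := fD (SigSub (mem_set (I : [set: nat] n))).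
  have gD n : ~ D (g n) by have [] := fD (SigSub (mem_set (I : [set: nat] n))).
  have gI : injective g.
    by move=> m n /val_inj /(@inj _ _ _ f) => /(_ (in_setT _) (in_setT _)) [].
  (* As [b + n.*2] runs once through all naturals, [G] is a bijection from two copies of the range
     of [g] onto that range. *)
  pose G := [set p | exists n (b : bool), p = ((g n, b), g (b + n.*2)%N)].
  apply: (Fmax (F `|` G)).
    split=> [p|]; first by left.
    move=> FG; apply: (gD 0); exists (g 1).
    by apply: FG; right; exists 0, true.
  split.
    move=> x b y [Fxy|[n [c [-> -> ->]]]].
      have [Ex Ey [z Fz] [w Fw]] := FE _ _ _ Fxy.
      by split=> //; [exists z|exists w]; left.
    split=> //.
      by exists (g (~~ c + n.*2)%N); right; exists n, (~~ c).
    by exists (g (true + (c + n.*2).*2)%N); right; exists (c + n.*2)%N, true.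
  move=> [[x b] y] [[x' b'] y'] /=.
  move=> [Fp|[n [c [-> -> ->]]]] [Fq|[n' [c' [-> -> ->]]]] E1.
  - exact: (FI _ _ Fp Fq).
  - by have [_ _ _] := FE _ _ _ Fp; rewrite E1 => /gD.
  - by have [_ _ _] := FE _ _ _ Fq; rewrite -E1 => /gD.
  - move/gI: E1 => E1.
    have cc : c = c'.
      by have := congr1 odd E1; rewrite !oddD !odd_double !addbF !oddb.
    by move: E1; rewrite cc => /addnI/double_inj ->.
have Dinf : infinite_set D.
  by move=> Dfin; apply: Einf; rewrite -(setDUK DE) finite_setU.
have ED : E #<= D.
  rewrite -(setDUK DE); apply: card_le_trans DD.
  by apply: card_leU; [exact: card_lexx|exact: card_le_infinite].
apply: card_le_trans (card_leX _ ED) _; apply: card_le_trans DD _.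
exact: subset_card_le.
Qed.

(** When the larger set is infinite, it absorbs the union by doubling; otherwise the union is
    finite. *)
Lemma card_ltU T U (A B : set T) (C : set U) :
  infinite_set C -> card_lt A C -> card_lt B C -> card_lt (A `|` B) C.
Proof.
move=> Cinf; wlog AB : A B / A #<= B.
  move=> H AC BC; have [AB|BA] := card_le_total A B; first exact: H.
  by rewrite setUC; exact: H.
move=> AC BC; have [Bfin|Binf] := pselect (finite_set B).
  by apply: card_lt_finite => //; rewrite finite_setU; split=> //;
    exact: card_le_finite AB Bfin.
apply: card_le_lt_trans BC; apply: card_le_trans (card_le_doubling Binf).
by apply: card_leU => //; exact: card_lexx.
Qed.

Lemma card_leTP T U :
  [set: T] #<= [set: U] <-> exists f : T -> U, injective f.
Proof.
split=> [/card_le_relP[R [totR injR]]|[f f_inj]].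
  have /choice[f fR] : forall x, exists y, R x y.
    by move=> x; have [y _] := totR x I; exists y.
  by exists f => x y fxy; apply: (injR _ _ (f x)) => //; rewrite fxy.
apply/card_le_relP; exists (fun x y => f x = y).
split=> [x _|]; first by exists (f x).
by move=> x x' y _ _ <- /f_inj.
Qed.

(** * Well-orders with small initial segments *)

Lemma well_order_exists T : exists lt : T -> T -> Prop,
  well_founded lt /\ forall x y, [\/ lt x y, x = y | lt y x].
Proof.
elim/Peq: T => T; have [R Rwo] := well_ordering_principle T.
exists (fun x y => ~~ R y x); split; last first.
  move=> x y; have [Rxy|nRxy] := boolP (R x y); last by constructor 3.
  have [Ryx|nRyx] := boolP (R y x); last by constructor 1.
  (* Antisymmetry of [R] comes from the uniqueness of minima: [x] and [y] are both least in the pair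
     [A]. *)
  constructor 2; pose A : {pred T} := pred2 x y.
  have Rzz z : R z z.
    have [|t [[]]] := Rwo (pred1 z); first by exists z; rewrite inE.
    by rewrite inE => /eqP-> /(_ z); rewrite inE eqxx => /(_ isT).
  have [|z [_ zU]] := Rwo A; first by exists x; rewrite inE eqxx.
  transitivity z; [symmetry|]; apply: zU;
    (split; first by rewrite inE eqxx ?orbT);
    by move=> t; rewrite inE => /orP[] /eqP->.
move=> x; apply: contrapT => nAx.
pose A : {pred T} := fun x => `[< ~ Acc (fun x y => ~~ R y x) x >].
have [|z [[/asboolP nAz zmin] _]] := Rwo A; first by exists x; exact/asboolP.
apply: nAz; constructor => y; apply: contraNP => nAy.
by apply: zmin; exact/asboolP.
Qed.

(** If some segment is too large, take the least such [x]: its segment receives an injection [h]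
    from [T], and the order pulled back along [h] has segments that embed in those of points below
    [x]. *)
Lemma well_order_small_segments T U : [set: T] #<= [set: U] ->
  exists lt : T -> T -> Prop, [/\ well_founded lt,
    forall x y, [\/ lt x y, x = y | lt y x] &
    forall x, card_lt [set y | lt y x] [set: U]].
Proof.
move=> TU; have [lt [ltwf lttri]] := well_order_exists T.
have [[x [Ux xmin]]|nomin] := pselect (exists x,
    [set: U] #<= [set y | lt y x] /\
    forall y, lt y x -> card_lt [set z | lt z y] [set: U]); last first.
  exists lt; split=> // x; elim/(well_founded_ind ltwf): x => x IH.
  by apply/card_ltNge => Ux; apply: nomin; exists x.
have /card_le_relP[R [totR injR]] := card_le_trans TU Ux.
have /choice[h hP] : forall t, exists s, lt s x /\ R t s.
  by move=> t; have [s] := totR t Logic.I; exists s.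
have h_inj : injective h.
  move=> t t' htt'; apply: (injR _ _ (h t)) => //; first by have [] := hP t.
  by rewrite htt'; have [] := hP t'.
exists (fun a b => lt (h a) (h b)); split.
- move=> a; have [z za] : exists z, h a = z by exists (h a).
  elim/(well_founded_ind ltwf): z a za => z IH a za.
  by constructor => b; rewrite za => /IH; apply.
- move=> a b; case: (lttri (h a) (h b)); first by constructor 1.
    by move/h_inj; constructor 2.
  by constructor 3.
- move=> a; apply: card_le_lt_trans (xmin (h a) (hP a).1).
  apply/card_le_relP; exists (fun b z => h b = z); split=> [b|].
    by exists (h b).
  by move=> b b' y _ _ <- /h_inj.
Qed.

(** * Counting pairs of subsets under GCH *)

(** For infinite [I], a pair of subsets amounts to a subset of [I * bool], hence of [I] by doubling,
    and GCH bounds the power set of [I] by [K]; for finite [I] there are finitely many pairs. *)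
Lemma card_le_power_pair (I K : Type) : GCH ->
  infinite_set [set: K] -> card_lt [set: I] [set: K] ->
  [set: set I * set I] #<= [set: K].
Proof.
move=> gch Kinf IK; have [Ifin|Iinf] := pselect (finite_set [set: I]).
  apply: card_le_infinite => //.
  have [n /card_le_relP[R [totR injR]]] := (finite_set_leP _).1 Ifin.
  have /choice[h hP] : forall i, exists j : 'I_n, R i j.
    by move=> i; have [j jn Rij] := totR i Logic.I; exists (Ordinal jn).
  pose code (A : set I) := [set j : 'I_n | `[< exists2 i, A i & h i = j >]]%SET.
  have codeE A i : (h i \in code A) = `[< A i >].
    rewrite inE; apply/asbool_equiv_eq; split=> [[i' Ai' hii']|];
      last by exists i.
    by rewrite -(injR i' i (h i))// -hii'.
  have code_inj : injective code.
    move=> A B AB; apply/funext => i; apply/propext.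
    by rewrite -(asboolE (A i)) -codeE AB codeE asboolE.
  apply: (@card_le_finite _ _ _ [set: {set 'I_n} * {set 'I_n}]) => //.
  apply/card_leTP; exists (fun p => (code p.1, code p.2)).
  by move=> [A B] [A' B'] [/code_inj-> /code_inj->].
have /card_leTP[d dI] : [set: I * bool] #<= [set: I].
  by have := card_le_doubling Iinf; rewrite setXTT.
have setK : [set: set I] #<= [set: K].
  by apply: contrapT => /card_ltNge KsI; apply: (gch I K).
apply: card_le_trans setK; apply/card_leTP.
exists (fun p => d @` [set q | if q.2 then p.1 q.1 else p.2 q.1]).
have dE (S : set (I * bool)) q : (d @` S) (d q) = S q.
  by apply/propext; split=> [[q' Sq' /dI <-]|]; [|exists q].
have decode p i b : (d @` [set q | if q.2 then p.1 q.1 else p.2 q.1]) (d (i, b))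
    = if b then p.1 i else p.2 i by exact: dE.
move=> [A B] [A' B'] E; congr pair; apply/funext => i.
  by have := decode (A, B) i true; rewrite E decode.
by have := decode (A, B) i false; rewrite E decode.
Qed.

(** * Extension by transfinite recursion *)

(** The order of construction [lt] is unrelated to [le], so the value at [q] must respect the
    prescribed values and all earlier points on both sides of [q]; small segments keep both sets of
    bounds within reach of the quasilattice property. *)
Lemma quasilattice_extension (K : Type) (d : Order.disp_t) (Y : porderType d)
    (I Q : Type) (le lt : Q -> Q -> Prop) (c : I -> Q) (f : I -> Y) :
  infinite_set [set: K] -> quasilattice K Y -> card_lt [set: I] [set: K] ->
  (forall q, le q q) -> (forall p q r, le p q -> le q r -> le p r) ->
  well_founded lt -> (forall p q, [\/ lt p q, p = q | lt q p]) ->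
  (forall q, card_lt [set p | lt p q] [set: K]) ->
  (forall i j, le (c i) (c j) -> f i <= f j) ->
  exists2 g : Q -> Y, forall p q, le p q -> g p <= g q &
    forall i, g (c i) = f i.
Proof.
move=> Kinf qY IK le_refl le_trans lt_wf lt_tri segK f_homo.
(* Two empty sets of bounds yield an element of [Y], the default value of [xget]. *)
have [y0 _] : exists y : Y,
    (forall a, set0 a -> a <= y) /\ (forall b, set0 b -> y <= b).
  by apply: qY => //; apply: card_lt_finite => //.
pose spec q (h : forall p, lt p q -> Y) y := [/\
  forall i, le (c i) q -> f i <= y, forall i, le q (c i) -> y <= f i,
  forall p pq, le p q -> h p pq <= y & forall p pq, le q p -> y <= h p pq].
pose g := Fix lt_wf (fun=> Y) (fun q h => xget y0 (spec q h)).
have gE q : g q = xget y0 (spec q (fun p _ => g p)).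
  rewrite /g Fix_eq // => {}q h h' hh'; congr (xget _ (spec q _)).
  by apply: functional_extensionality_dep => p; apply/funext => pq; exact: hh'.
(* By well-founded induction, the specifications at earlier points make the bounds at [q]
   compatible, so a value meeting [spec] exists. *)
have gP q : spec q (fun p _ => g p) (g q).
  elim/(well_founded_ind lt_wf): q => q IH; rewrite gE; apply: xgetPex.
  have fK (J : set I) : card_lt (f @` J) [set: K].
    apply: card_le_lt_trans IK.
    exact: card_le_trans (card_image_le _ _) (card_leT _).
  have gK (S : set Q) : card_lt (g @` [set p | lt p q /\ S p]) [set: K].
    apply: card_le_lt_trans (card_image_le _ _) _.
    by apply: card_le_lt_trans (segK q); apply: subset_card_le => p [].
  have := qY (f @` [set i | le (c i) q] `|` g @` [set p | lt p q /\ le p q])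
             (f @` [set i | le q (c i)] `|` g @` [set p | lt p q /\ le q p]).
  case.
  - by apply: card_ltU.
  - by apply: card_ltU.
  - move=> _ _ [[i /= iq <-]|[p /= [pq lepq] <-]]
      [[j /= qj <-]|[r /= [rq leqr] <-]].
    + exact/f_homo/(le_trans _ q).
    + by have [+ _ _ _] := IH r rq; apply; exact: le_trans leqr.
    + by have [_ + _ _] := IH p pq; apply; exact: le_trans qj.
    (* Of [p] and [r], the one later for [lt] was chosen in accordance with the earlier one. *)
    + have lepr := le_trans _ _ _ lepq leqr.
      case: (lt_tri p r) => [pr|->//|rp].
        by have [_ _ + _] := IH r rq; apply.
      by have [_ _ _ +] := IH p pq; apply.
  - move=> y [yl yu]; exists y; split=> [i iq|i qi|p pq lepq|p pq leqp].
    + by apply: yl; left; exists i.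
    + by apply: yu; left; exists i.
    + by apply: yl; right; exists p.
    + by apply: yu; right; exists p.
exists g => [p q lepq|i].
  case: (lt_tri p q) => [pq|->//|qp].
    by have [_ _ + _] := gP q; apply.
  by have [_ _ _ +] := gP p; apply.
by have [l u _ _] := gP (c i); apply/le_anti; rewrite l// u.
Qed.

(** The codes range over a set that depends only on [A], so the bound on [A] suffices however large
    [X] is. *)
Lemma quasilattice_isotone_extends (K : Type) (dY dX : Order.disp_t)
    (Y : porderType dY) (X : porderType dX) (A : set X) (f : A -> Y) :
  GCH -> infinite_set [set: K] -> quasilattice K Y -> card_lt A [set: K] ->
  Order.nondecreasing f -> isotone_extends f.
Proof.
move=> gch Kinf qY /card_lt_setT AK f_homo.
have [lt [lt_wf lt_tri segK]] :=
  well_order_small_segments (card_le_power_pair gch Kinf AK).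
pose le (p q : set A * set A) := p.1 `<=` q.1 /\ q.2 `<=` p.2.
pose code (x : X) : set A * set A :=
  ([set a : A | val a <= x], [set a : A | x <= val a]).
have [|||g g_homo gf] :=
  @quasilattice_extension K _ Y A _ le lt (code \o val) f Kinf qY AK
    _ _ lt_wf lt_tri segK.
- by move=> q; split.
- move=> p q r [pq qp] [qr rq]; split.
    exact: subset_trans qr.
  exact: subset_trans qp.
(* [a] lies in its own lower set, so inclusion of lower sets gives [val a <= val b]. *)
- move=> a b [/(_ a) ab _]; apply: f_homo.
  by move: ab => /=; rewrite lexx leEsub; apply.
exists (g \o code) => [x y xy|a]; last by rewrite -gf.
by apply: g_homo; split=> a /= ax; [exact: le_trans xy|exact: le_trans ax].
Qed.

(** * The cut poset and the converse direction *)

(** Keeping [r] as a parameter lets the order instance depend on it; distinct points of equal rank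
    will be incomparable. *)
Definition ranked (T : choiceType) (r : T -> nat) : Type := T.

Section RankedOrder.
Variables (T : choiceType) (r : T -> nat).

HB.instance Definition _ := Choice.on (ranked r).

Definition ranked_le (x y : ranked r) := (x == y) || (r x < r y)%N.

Lemma ranked_le_refl : reflexive ranked_le.
Proof. by move=> x; rewrite /ranked_le eqxx. Qed.

Lemma ranked_le_anti : antisymmetric ranked_le.
Proof.
move=> x y /andP[/orP[/eqP//|xy] /orP[/eqP//|yx]].
by have := ltn_trans xy yx; rewrite ltnn.
Qed.

Lemma ranked_le_trans : transitive ranked_le.
Proof.
move=> y x z /orP[/eqP->//|xy] /orP[/eqP<-|yz]; rewrite /ranked_le ?xy ?orbT//.
by rewrite (ltn_trans xy yz) orbT.
Qed.

HB.instance Definition _ := Order.Le_isPOrder.Build (Order.Disp tt tt)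
  (ranked r) ranked_le_refl ranked_le_anti ranked_le_trans.

End RankedOrder.

Section Cut.
Variables (dY : Order.disp_t) (Y : porderType dY) (A B : set Y).

Definition cut_rank (t : option (A + B)) : nat :=
  match t with Some (inl _) => 0 | None => 1 | Some (inr _) => 2 end.

(* The antichains [A] and [B] with one point [None] above [A] and below [B]. *)
Definition cut : Type := ranked cut_rank.
HB.instance Definition _ := Order.POrder.on cut.

Lemma card_lt_cut K : infinite_set [set: K] ->
  card_lt A [set: K] -> card_lt B [set: K] -> card_lt [set: cut] [set: K].
Proof.
move=> Kinf /card_lt_setT AK /card_lt_setT BK.
have -> : [set: cut] = ((Some \o inl) @` [set: A] `|` (Some \o inr) @` [set: B])
    `|` [set None].
  by apply/seteqP; split=> // -[[a|b]|] _;
    [do 2 left; exists a|left; right; exists b|right].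
apply: card_ltU => //; last exact: card_lt_finite.
by apply: card_ltU => //; apply: card_le_lt_trans (card_image_le _ _) _.
Qed.

(** The value of an extension at [e None] is the required [y]. A general embedding [e] covers both
    the cut itself and its copy in [P]. *)
Lemma cut_extension (y0 : Y) (dX : Order.disp_t) (X : porderType dX)
    (e : cut -> X) :
  {mono e : x y / x <= y} -> (forall a b, A a -> B b -> a <= b) ->
  (forall f : e @` [set t : cut | t <> None] -> Y,
    Order.nondecreasing f -> isotone_extends f) ->
  exists y : Y, (forall a, A a -> a <= y) /\ (forall b, B b -> y <= b).
Proof.
move=> e_mono AB ext.
(* [y0] is a dummy value: [None] is outside the domain that gets extended. *)
pose F (t : cut) := match t with
  Some (inl a) => val a | None => y0 | Some (inr b) => val b end.
have F_homo (t u : cut) : t <> None -> u <> None -> t <= u -> F t <= F u.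
  move=> + + /orP[/eqP->//|].
  case: t u => [[a|b]|] [[a'|b']|] //= _ _ _.
  by apply: AB; exact/set_mem/valP.
have /choice[h hP] : forall x : e @` [set t : cut | t <> None],
    exists t, t <> None /\ e t = val x.
  by move=> x; have [t tN etx] := set_mem (valP x); exists t.
have [x y|g g_homo gF] := ext (F \o h).
  rewrite leEsub => xy; have [[hx ehx] [hy ehy]] := (hP x, hP y).
  by apply: F_homo => //; rewrite -e_mono ehx ehy.
have gFe t : t <> None -> g (e t) = F t.
  move=> tN; have et : e t \in e @` [set t : cut | t <> None].
    by apply/mem_set; exists t.
  have [_ ehx] := hP (SigSub et).
  rewrite -[e t]/(val (SigSub et)) gF /=; congr F.
  (* An order embedding is injective, so [h] inverts [e]. *)
  by apply: le_anti; rewrite -!e_mono ehx lexx.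
exists (g (e None)); split=> [a /mem_set aA|b /mem_set bB].
  rewrite -[a]/(F (Some (inl (SigSub aA)))) -gFe//.
  by apply: g_homo; rewrite e_mono.
rewrite -[b]/(F (Some (inr (SigSub bB)))) -gFe//.
by apply: g_homo; rewrite e_mono.
Qed.

End Cut.

Theorem theorem4p16 :
  GCH ->
  forall (dY dP : Order.disp_t) (Y : porderType dY) (K : Type)
    (P : porderType dP),
  [set: Y] !=set0 ->
  infinite_set [set: K] ->
  universal K P ->
  [<-> quasilattice K Y;
       forall (dX : Order.disp_t) (X : porderType dX),
         card_lt [set: X] [set: K] ->
         forall (A : set X) (f : A -> Y),
           Order.nondecreasing f -> isotone_extends f;
       forall (dX : Order.disp_t) (X : porderType dX) (A : set X),
         card_lt A [set: K] ->
         forall f : A -> Y, Order.nondecreasing f -> isotone_extends f;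
       forall A : set P,
         card_lt A [set: K] ->
         forall f : A -> Y, Order.nondecreasing f -> isotone_extends f].
Proof.
move=> gch dY dP Y K P [y0 _] Kinf Puniv; tfae.
- move=> qY dX X XK A f.
  apply: (quasilattice_isotone_extends gch Kinf qY).
  by apply: card_le_lt_trans (card_leT A) XK.
(* This step passes through (i), obtained by extending over the cut itself, with [e] the
   identity. *)
- move=> ext dX X A AK f.
  apply: (quasilattice_isotone_extends gch Kinf) => // B C BK CK BC.
  apply: (@cut_extension _ _ B C y0 _ (cut B C) id) => // h.
  by apply: ext; exact: card_lt_cut.
- by move=> ext A; exact: ext.
- move=> ext A B AK BK AB.
  have cutK := card_lt_cut Kinf AK BK.
  have [S [e _ e_mono]] := Puniv _ (cut A B) cutK.
  apply: (@cut_extension _ _ A B y0 _ P (val \o e)) => // f.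
  apply: ext; apply: card_le_lt_trans cutK.
  exact: card_le_trans (card_image_le _ _) (card_leT _).
Qed.
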